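(* Let $A$ be a closed symmetric linear relation in a Hilbert space $\mathfrak H$ with equal finite deficiency indices $n_+(A)=n_-(A)<\infty$ and let $\Pi=\{\mathcal H,\Gamma_0,\Gamma_1\}$ be a boundary triplet for $A^*$. Let $C=(C_0,C_1)$ be an entire Nevanlinna pair in $\mathcal H$, let $\tau=\tau_C\in\widetilde R_{\rm mer}(\mathcal H)$ be the relation-valued function $$\tau_C(\lambda)=\{\{h,h'\}\in\mathcal H^2:C_0(\lambda)h+C_1(\lambda)h'=0\},\quad\lambda\in\mathbb C\setminus\mathbb R,$$ and let $\widetilde A_\tau$ be the corresponding exit space self-adjoint extension of $A$. Then the equality (the abstract boundary condition) $$S_{\widetilde A_\tau}(t)=\{\widehat f\in A^*:C_0(t)\Gamma_0\widehat f-C_1(t)\Gamma_1\widehat f=0\},\qquad t\in\mathbb R,$$ defines the Shtraus family $S_{\widetilde A_\tau}(t)$ of $\widetilde A_\tau$.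
   Context: Hilbert spaces are complex and separable; $B(\mathcal H)$ denotes bounded operators. A linear relation in $\mathcal H$ is a linear subspace $T\subset\mathcal H\oplus\mathcal H$ with elements $\{f,f'\}$; operators are identified with their graphs. $\operatorname{mul}T=\{f':\{0,f'\}\in T\}$, $T-\lambda=\{\{f,f'-\lambda f\}:\{f,f'\}\in T\}$, $-T=\{\{f,-f'\}\}$, $T^{-1}=\{\{f',f\}\}$, $T^*=\{\{g,g'\}:(f',g)=(f,g')\ \forall\{f,f'\}\in T\}$; $T$ is symmetric if $T\subset T^*$, self-adjoint if $T=T^*$. $n_\pm(A)=\dim\ker(A^*-\lambda)$, $\lambda\in\mathbb C_\pm$. Boundary triplet for $A^*$: a Hilbert space $\mathcal H$ and linear maps $\Gamma_0,\Gamma_1:A^*\to\mathcal H$ such that $(\Gamma_0,\Gamma_1)^\top:A^*\to\mathcal H\oplus\mathcal H$ is surjective and $(f',g)-(f,g')=(\Gamma_1\widehat f,\Gamma_0\widehat g)-(\Gamma_0\widehat f,\Gamma_1\widehat g)$ for all $\widehat f=\{f,f'\},\widehat g=\{g,g'\}\in A^*$ (then $\dim\mathcal H=n_\pm(A)$). For a relation $\theta$ in $\mathcal H$, $A_\theta=\{\widehat f\in A^*:\{\Gamma_0\widehat f,\Gamma_1\widehat f\}\in\theta\}$. Entire Nevanlinna pair in a finite-dimensional $\mathcal H$: entire $C_0,C_1:\mathbb C\to B(\mathcal H)$ with $\operatorname{Im}\lambda\cdot\operatorname{Im}(C_1(\lambda)C_0^*(\lambda))\ge0$, $C_1(\lambda)C_0^*(\bar\lambda)-C_0(\lambda)C_1^*(\bar\lambda)=0$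 for $\lambda\in\mathbb C\setminus\mathbb R$, and $(C_0(\lambda),C_1(\lambda)):\mathcal H\oplus\mathcal H\to\mathcal H$ surjective for all $\lambda\in\mathbb C$. $\widetilde R(\mathcal H)$: functions $\tau$ on $\mathbb C\setminus\mathbb R$ whose values are closed linear relations in $\mathcal H$ such that $\operatorname{Im}(f',f)\ge0$ for $\{f,f'\}\in\tau(\lambda)$, $\lambda\in\mathbb C_+$; $(\tau(\lambda)+i)^{-1}\in B(\mathcal H)$ for $\lambda\in\mathbb C_+$ and is holomorphic there; $\tau^*(\lambda)=\tau(\bar\lambda)$. With $\mathcal K=\operatorname{mul}\tau(\lambda)$ (independent of $\lambda$) and $\mathcal H_0=\mathcal H\ominus\mathcal K$ one has $\tau(\lambda)=\{\{h_0,\tau_0(\lambda)h_0+k\}:h_0\in\mathcal H_0,k\in\mathcal K\}$; $\tau\in\widetilde R_{\rm mer}(\mathcal H)$ means that the operator part $\tau_0$ extends to an entire or meromorphic function on $\mathbb C$. Exit space extension of $A$: a relation $\widetilde A=\widetilde A^*$ in a Hilbert space $\widetilde{\mathfrak H}\supset\mathfrak H$ with $A\subset\widetilde A$ and no nontrivial subspace of $\widetilde{\mathfrak H}\ominus\mathfrak H$ reducing $\widetilde A$; extensions unitarily equivalent via a unitary that is the identity on $\mathfrak H$ are identified. For each $\tau\in\widetilde R(\mathcal H)$, $\widetilde A_\tau$ is the unique exit space extension with $P_{\mathfrak H}(\widetilde A_\tau-\lambda)^{-1}|_{\mathfrak H}=(A_{-\tau(\lambda)}-\lambda)^{-1}$,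 $\lambda\in\mathbb C\setminus\mathbb R$. Shtraus family of $\widetilde A$: with $\mathfrak H_r=\widetilde{\mathfrak H}\ominus\mathfrak H$, $S_{\widetilde A}(\lambda)=\{\{f,f'\}\in\mathfrak H^2:\{f\oplus f_r,f'\oplus\lambda f_r\}\in\widetilde A\text{ for some }f_r\in\mathfrak H_r\}$, $\lambda\in\mathbb C$. *)

(* Defs.v *)
From HB Require Import structures.
From mathcomp Require Import all_boot all_order all_algebra.
From mathcomp Require Import all_classical all_reals all_analysis.
From mathcomp Require Export complex.
Import Order.TTheory GRing.Theory Num.Theory.
Import numFieldNormedType.Exports.

Set Implicit Arguments.
Unset Strict Implicit.
Unset Printing Implicit Defensive.

Local Open Scope classical_set_scope.
Local Open Scope ring_scope.

(* The inner product is linear in its first argument and conjugate-linear in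
   the second one. *)
Record hilbertSpace (R : realType) := HilbertSpace {
  hcarrier :> completeNormedModType R[i] ;
  hdot : {dot hcarrier for (@Num.conj R[i])} ;
  hnormE : forall x : hcarrier, `|x| ^+ 2 = hdot x x ;
  hseparable : exists2 D : set hcarrier, countable D & dense D }.

Arguments hdot {R h}.

Section Subspaces.
Context {R : realType}.

Definition is_subspace (V : lmodType R[i]) (S : set V) : Prop :=
  S 0 /\ forall (a : R[i]) x y, S x -> S y -> S (a *: x + y).

Definition has_dim (V : lmodType R[i]) (S : set V) (n : nat) : Prop :=
  exists e : 'I_n -> V,
    (forall c : 'I_n -> R[i],
       \sum_(i < n) c i *: e i = 0 -> forall i, c i = 0) /\
    S = [set x | exists c : 'I_n -> R[i], x = \sum_(i < n) c i *: e i].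

Definition ortho_compl (X : hilbertSpace R) (S : set X) : set X :=
  [set x : X | forall y, S y -> hdot x y = 0].

End Subspaces.

(* Relations are subsets of the product space; the (max) norm of the library on
   the product induces the topology of the Hilbert sum. *)
Definition relation_in {R : realType} (X : hilbertSpace R) := set (X * X).

Section Relations.
Context {R : realType} {X : hilbertSpace R}.
Implicit Types (T : relation_in X) (l : R[i]).

Definition rel_ker T : set X := [set f : X | T (f, 0)].

Definition rel_shift T l : relation_in X :=
  [set g : X * X | exists2 f, T f & g = (f.1, f.2 - l *: f.1)].

Definition rel_opp T : relation_in X :=
  [set g : X * X | exists2 f, T f & g = (f.1, - f.2)].

Definition rel_inv T : relation_in X :=
  [set g : X * X | exists2 f, T f & g = (f.2, f.1)].

Definition rel_adj T : relation_in X :=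
  [set g : X * X | forall f, T f -> hdot f.2 g.1 = hdot f.1 g.2].

Definition symmetric_relation T : Prop :=
  is_subspace T /\ T `<=` rel_adj T.

Definition self_adjoint_relation T : Prop :=
  is_subspace T /\ T = rel_adj T.

Definition reduces (M : set X) T : Prop :=
  T = [set f : X * X | exists g h : X * X,
         [/\ T g, M g.1 & M g.2] /\
         [/\ T h, ortho_compl M h.1 & ortho_compl M h.2] /\
         f = (g.1 + h.1, g.2 + h.2)].

(* n_+(A) = n and n_-(A) = n *)
Definition deficiency_plus (A : relation_in X) (n : nat) : Prop :=
  forall l, 0 < 'Im l -> has_dim (rel_ker (rel_shift (rel_adj A) l)) n.

Definition deficiency_minus (A : relation_in X) (n : nat) : Prop :=
  forall l, 'Im l < 0 -> has_dim (rel_ker (rel_shift (rel_adj A) l)) n.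

End Relations.

Section BoundaryTriplets.
Context {R : realType} {X H : hilbertSpace R}.
Implicit Types (A : relation_in X) (G : X * X -> H).

(* The boundary maps live on A^*; they are represented by functions on the
   whole X * X whose values outside A^* are irrelevant. *)
Definition linear_on (D : set (X * X)) G : Prop :=
  forall (a : R[i]) f g, D f -> D g -> G (a *: f + g) = a *: G f + G g.

Definition boundary_triplet A (G0 G1 : X * X -> H) : Prop :=
  [/\ linear_on (rel_adj A) G0,
      linear_on (rel_adj A) G1,
      (forall h0 h1 : H, exists2 f, rel_adj A f & G0 f = h0 /\ G1 f = h1) &
      forall f g, rel_adj A f -> rel_adj A g ->
        hdot f.2 g.1 - hdot f.1 g.2 = hdot (G1 f) (G0 g) - hdot (G0 f) (G1 g)].

Definition boundary_ext A (G0 G1 : X * X -> H) (theta : relation_in H) :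
    relation_in X :=
  [set f : X * X | rel_adj A f /\ theta (G0 f, G1 f)].

End BoundaryTriplets.

Section NevanlinnaPairs.
Context {R : realType} {H : hilbertSpace R}.

Definition bounded_operator (B : H -> H) : Prop :=
  exists M : R[i], forall h, `|B h| <= M * `|h|.

(* For a bounded linear B the vector z below exists (Riesz) and is unique. *)
Definition op_adj (B : H -> H) : H -> H :=
  fun y => xget 0 [set z : H | forall x, hdot (B x) y = hdot x z].

Definition op_im (B : H -> H) : H -> H :=
  fun h => (2 * 'i)^-1 *: (B h - op_adj B h).

Definition op_ge0 (B : H -> H) : Prop := forall h, 0 <= hdot (B h) h.

(* Holomorphy in operator norm: the last inequality says that the difference
   quotient of F differs from the bounded operator D by at most e in norm. *)
Definition entire_operator_function (F : R[i] -> {linear H -> H}) : Prop :=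
  (forall z, bounded_operator (F z)) /\
  forall z, exists2 D : {linear H -> H}, bounded_operator D &
    forall e : R[i], 0 < e -> exists2 d : R[i], 0 < d &
      forall w, w != z -> `|w - z| < d ->
        forall h, `|(w - z)^-1 *: (F w h - F z h) - D h| <= e * `|h|.

Definition entire_nevanlinna_pair (C0 C1 : R[i] -> {linear H -> H}) : Prop :=
  [/\ entire_operator_function C0,
      entire_operator_function C1,
      (forall l, 'Im l != 0 ->
         op_ge0 (fun h => 'Im l *: op_im (C1 l \o op_adj (C0 l)) h)),
      (forall l, 'Im l != 0 -> forall h,
         C1 l (op_adj (C0 l^*) h) - C0 l (op_adj (C1 l^*) h) = 0) &
      forall l h, exists h0 h1, C0 l h0 + C1 l h1 = h].

Definition tau_of (C0 C1 : R[i] -> {linear H -> H}) (l : R[i]) :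
    relation_in H :=
  [set f : H * H | C0 l f.1 + C1 l f.2 = 0].

End NevanlinnaPairs.

(* The inclusion of X in a larger Hilbert space K is a linear isometry
   J : X -> K, and the exit space is the orthogonal complement of its range. *)
Section ExitSpaceExtensions.
Context {R : realType} {X K : hilbertSpace R}.
Implicit Types (J : {linear X -> K}) (T : relation_in K).

Definition exit_space J : set K := ortho_compl (range J).

Definition exit_space_extension (A : relation_in X) J T : Prop :=
  [/\ forall x y, hdot (J x) (J y) = hdot x y,
      self_adjoint_relation T,
      (forall f, A f -> T (J f.1, J f.2)) &
      forall M : set K, is_subspace M -> closed M -> M `<=` exit_space J ->
        reduces M T -> M = [set 0]].

(* P T | X, where P is the orthogonal projection of K onto X *)
Definition compression J T : relation_in X :=
  [set f : X * X | exists2 u, T (J f.1, u) & exit_space J (u - J f.2)].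

Definition shtraus_family J T (l : R[i]) : relation_in X :=
  [set f : X * X | exists2 r, exit_space J r & T (J f.1 + r, J f.2 + l *: r)].

End ExitSpaceExtensions.

(* T is (a representative of) the exit space extension of A corresponding to
   the relation-valued function tau on the nonreal complex numbers. *)
Definition corresponding_extension {R : realType} {X H K : hilbertSpace R}
    (A : relation_in X) (G0 G1 : X * X -> H) (tau : R[i] -> relation_in H)
    (J : {linear X -> K}) (T : relation_in K) : Prop :=
  exit_space_extension A J T /\
  forall l : R[i], 'Im l != 0 ->
    compression J (rel_inv (rel_shift T l)) =
    rel_inv (rel_shift (boundary_ext A G0 G1 (rel_opp (tau l))) l).

(* Main.v *)
Require Import Defs.
From mathcomp Require Import all_boot all_order all_algebra.
From mathcomp Require Import all_classical all_reals all_analysis.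
From mathcomp Require Import ring lra.
Import Order.TTheory GRing.Theory Num.Theory.
Import numFieldNormedType.Exports.
Local Open Scope classical_set_scope.
Local Open Scope ring_scope.
Local Open Scope complex_scope.

(** Write [adj B] for the adjoint of an operator [B] and [S(l)] for the Shtraus
    relation at [l]. At nonreal [l], the compressed resolvent of the extension
    is the resolvent of [S(l)], so the defining property of the extension says
    that [S(l)] is given by the boundary condition [C0(l) G0 f = C1(l) G1 f]
    ([shtraus_nonreal]). The issue is to pass to a real point [t].

    The boundary condition at [t] implies membership in [S(t)]
    ([boundary_condition_sub_shtraus]). The boundary space has finite dimension
    ([boundary_space_finite_dim]), and the symmetry and surjectivity of the pair
    make the solutions of [C0(t) h = C1(t) h'] exactly the vectors
    [h = adj C1(t) u], [h' = adj C0(t) u] ([kernel_parametrization]). Replacing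
    [t] by [l = t + i x] and the operators by their adjoints at the conjugate of
    [l], one gets solutions at [l] that depend holomorphically on [l]. They lift
    to elements [f_l] of [S(l)] converging to the given [f], which come with
    vectors [r_l] of the exit space such that [f_l + r_l, f_l' + l r_l] is in the
    extension. Self-adjointness yields ([shtraus_green])
      [(l - conj k) (r_l, r_k) = (h_l, h'_k) - (h'_l, h_k)],
    and the right-hand side, which vanishes for [l = conj k], is differentiable.
    Hence [(r_l, r_k)] has a limit as [l] and [k] tend to [t]
    ([nevanlinna_kernel_gram]); so the [r_l] converge in norm, and since the
    extension is closed, [f] belongs to [S(t)].

    Conversely, [S(t)] is a symmetric relation contained in the adjoint of [A].
    It contains elements with boundary values [(adj C1(t) u, adj C0(t) u)] for
    every [u], and the vanishing of the boundary form between them and an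
    element of [S(t)] is the boundary condition for the latter
    ([shtraus_sub_boundary_condition]). *)

(** * Inner products and limits *)

Section Hilbert.
Context {R : realType} {X : hilbertSpace R}.
Implicit Types (x y z : X) (a : R[i]).

Lemma hdotDl x y z : hdot (x + y) z = hdot x z + hdot y z.
Proof. exact: linearDl. Qed.
Lemma hdotDr x y z : hdot z (x + y) = hdot z x + hdot z y.
Proof. exact: linearDr. Qed.
Lemma hdotBl x y z : hdot (x - y) z = hdot x z - hdot y z.
Proof. exact: linearBl. Qed.
Lemma hdotBr x y z : hdot z (x - y) = hdot z x - hdot z y.
Proof. exact: linearBr. Qed.
Lemma hdotZl a x z : hdot (a *: x) z = a * hdot x z.
Proof. exact: linearZl_LR. Qed.
Lemma hdotZr a x z : hdot z (a *: x) = Num.conj a * hdot z x.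
Proof. exact: linearZr_LR. Qed.
Lemma hdot0l z : hdot 0 z = 0.
Proof. exact: linear0l. Qed.
Lemma hdot0r z : hdot z 0 = 0.
Proof. exact: linear0r. Qed.
Lemma hdotNl x z : hdot (- x) z = - hdot x z.
Proof. exact: linearNl. Qed.
Lemma hdotNr x z : hdot z (- x) = - hdot z x.
Proof. exact: linearNr. Qed.
Lemma hdotC x y : hdot x y = Num.conj (hdot y x).
Proof. by rewrite hermC expr0 mul1r. Qed.

Lemma hdot_ge0 x : 0 <= hdot x x.
Proof. by rewrite -hnormE exprn_ge0. Qed.

Lemma hdot_eq0 x : hdot x x = 0 -> x = 0.
Proof. by move/eqP; rewrite -hnormE sqrf_eq0 normr_eq0 => /eqP. Qed.

Lemma hdot_inj x y : (forall z, hdot x z = hdot y z) -> x = y.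
Proof.
move=> xy; apply/eqP; rewrite -subr_eq0; apply/eqP/hdot_eq0.
by rewrite hdotBl xy subrr.
Qed.

Lemma hdot_gt0 x : x != 0 -> 0 < hdot x x.
Proof. by move=> x0; rewrite -hnormE exprn_gt0 // normr_gt0. Qed.

(** Subtracting from [x] its component along [y] lowers the squared norm by an
    explicit amount; this gives both the Cauchy-Schwarz inequality and the
    orthogonality of the minimizing residual in [projection]. *)
Lemma hdot_residual x y (c := hdot x y / hdot y y) : y != 0 ->
  hdot (x - c *: y) (x - c *: y) = hdot x x - `|hdot x y| ^+ 2 / hdot y y.
Proof.
move=> /hdot_gt0 yy0; rewrite /c {c}.
rewrite hdotBl hdotBr [hdot _ (x - _)]hdotBr !hdotZl !hdotZr.
set q := hdot x y; set d := hdot y y; rewrite (hdotC y x) -/q.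
have -> : q / d * ((q / d)^* * d) = (q / d)^* * q.
  by rewrite mulrCA mulfVK ?gt_eqF.
by rewrite opprB addrA subrK normCK mulrAC.
Qed.

Lemma cauchy_schwarz x y : `|hdot x y| <= `|x| * `|y|.
Proof.
have [->|y0] := eqVneq y 0; first by rewrite hdot0r !normr0 mulr0.
rewrite -(@ler_pXn2r _ 2) ?nnegrE ?mulr_ge0 // exprMn !hnormE.
rewrite -ler_pdivrMr ?hdot_gt0 // -subr_ge0 -hdot_residual //.
Qed.

(** The inner product is a polynomial in norms, so that its continuity follows
    from that of the norm. *)
Lemma polarization x y :
  hdot x y = (`|x + y| ^+ 2 - `|x - y| ^+ 2
    + 'i%R * `|x + 'i%R *: y| ^+ 2 - 'i%R * `|x - 'i%R *: y| ^+ 2) / 4.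
Proof.
apply: (mulIf (_ : (4 : R[i]) != 0)); first by rewrite pnatr_eq0.
rewrite mulfVK ?pnatr_eq0 // !hnormE !(hdotDl, hdotDr).
rewrite !(hdotNl, hdotNr, hdotZl, hdotZr) conjCi.
have := sqrCi R[i]; set j := Num.imaginary => j2.
set p := hdot x x; set q := hdot x y; set r := hdot y x; set s := hdot y y.
have -> : q * 4 = 2 * (q + r) + 2 * (- 1) * (r - q) by ring.
by rewrite -j2; ring.
Qed.

Lemma hdot_cvg {T : Type} {F : set_system T} {FF : Filter F}
    (u v : T -> X) (x y : X) :
  u @ F --> x -> v @ F --> y -> hdot (u n) (v n) @[n --> F] --> hdot x y.
Proof.
move=> ux vy; rewrite polarization.
under eq_fun do rewrite polarization.
have nrm (w : T -> X) (z : X) : w @ F --> z ->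
    `|w n| ^+ 2 @[n --> F] --> `|z| ^+ 2.
  by move=> wz; apply: cvgM; apply: cvg_norm.
have vyi : 'i%R *: v n @[n --> F] --> 'i%R *: y by apply: cvgZl_tmp.
apply: cvgM; last exact: cvg_cst.
apply: cvgB; last first.
  by apply: cvgM; [exact: cvg_cst | apply: nrm; apply: cvgB].
apply: cvgD; last first.
  by apply: cvgM; [exact: cvg_cst | apply: nrm; apply: cvgD].
by apply: cvgB; apply: nrm; [apply: cvgD | apply: cvgB].
Qed.

Lemma cvg_seq_unique (u : nat -> X) (x y : X) :
  u @ \oo --> x -> u @ \oo --> y -> x = y.
Proof. by apply: cvg_unique; exact: norm_hausdorff. Qed.

(** The library norm has values in [R[i]], whose order is only partial; infima
    and archimedean bounds are taken on this real-valued squared norm. *)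
Definition sqn x : R := complex.Re (hdot x x).

Lemma sqnE x : (sqn x)%:C = hdot x x.
Proof. by rewrite /sqn RRe_real // ger0_real // hdot_ge0. Qed.

Lemma sqn_ge0 x : 0 <= sqn x.
Proof. by rewrite -lecR sqnE hdot_ge0. Qed.

Lemma sqn_cauchy_cvg (u : nat -> X) :
  (forall e : R, 0 < e -> exists N, forall k l, (N <= k)%N -> (N <= l)%N ->
     sqn (u k - u l) <= e) ->
  exists x, u @ \oo --> x.
Proof.
move=> uC.
suff: cvg (u @ \oo) by move=> h; exists (lim (u @ \oo)).
apply/cauchy_cvgP/cauchy_exP => e e0.
have eE : (complex.Re e)%:C = e by rewrite RRe_real // gtr0_real.
have e0' : 0 < complex.Re e by rewrite -ltcR eE.
have [N uN] := uC (complex.Re e ^+ 2 / 2) ltac:(by rewrite divr_gt0 ?exprn_gt0).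
exists (u N); exists N => // k /= Nk.
rewrite -ball_normE /ball_ /= -(@ltr_pXn2r _ 2) ?nnegrE //; last exact: ltW.
rewrite hnormE -sqnE -eE -rmorphXn ltcR.
apply: le_lt_trans (uN _ _ (leqnn N) Nk) _.
by rewrite ltr_pdivrMr // ltr_pMr ?exprn_gt0 // ltr1n.
Qed.

End Hilbert.

(** * Orthogonal projection *)

Section Projection.
Context {R : realType} {X : hilbertSpace R}.
Implicit Types (x y z : X) (a : R[i]).

Lemma sqn_parallelogram x y : sqn (x - y) + sqn (x + y) = 2 * (sqn x + sqn y).
Proof.
apply: complexI; rewrite rmorphM !rmorphD /= !sqnE.
rewrite !(hdotBl, hdotDl) !(hdotBr, hdotDr) rmorph1.
by ring.
Qed.

Lemma sqnZ a x : (sqn (a *: x))%:C = `|a| ^+ 2 * (sqn x)%:C.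
Proof. by rewrite !sqnE hdotZl hdotZr mulrA normCK. Qed.

Lemma sqn_cvg {T : Type} {F : set_system T} {FF : Filter F}
    (u : T -> X) (x : X) :
  u @ F --> x -> sqn (u n) @[n --> F] --> sqn x.
Proof.
move=> ux; apply/cvgrPdist_lt => e e0.
have h : hdot (u n) (u n) @[n --> F] --> hdot x x by exact: hdot_cvg.
move/cvgrPdist_lt/(_ e%:C): h.
rewrite ltcR => /(_ e0); apply: filterS => n.
rewrite -!sqnE -rmorphB /= => h; rewrite -ltcR; apply: le_lt_trans h.
exact: (normc_ge_Re (_ %:C)).
Qed.

(** A sequence in [M] whose distances to [y] approach the infimum is Cauchy by
    the parallelogram identity, and the residual at its limit is orthogonal to
    [M] since it cannot be shortened. Closedness is asked for along sequences,
    the form in which it is available for ranges of relations. *)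
Lemma projection (M : set X) y : is_subspace M ->
  (forall (u : nat -> X) x, (forall k, M (u k)) -> u @ \oo --> x -> M x) ->
  exists2 m, M m & forall z, M z -> hdot (y - m) z = 0.
Proof.
move=> [M0 Mlin] Mcl.
have MD p q : M p -> M q -> M (p + q).
  by move=> Mp Mq; rewrite -(scale1r p); apply: Mlin.
have MZ a p : M p -> M (a *: p)
  by move=> Mp; rewrite -(addr0 (a *: p)); apply: Mlin.
pose E : set R := [set r | exists2 m, M m & r = sqn (y - m)].
have Einf : has_inf E.
  split; first by exists (sqn (y - 0)), 0.
  by exists 0 => _ [m _ ->]; apply: sqn_ge0.
pose d := inf E.
have dle m : M m -> d <= sqn (y - m).
  by move=> Mm; apply: ge_inf; [exact: (proj2 Einf) | exists m].
have dex k : exists m, M m /\ sqn (y - m) < d + k.+1%:R^-1.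
  have k0 : 0 < (k.+1%:R^-1 : R) by rewrite invr_gt0.
  by have [_ [m Mm ->] h] := inf_adherent k0 Einf; exists m.
have [m /all_and2[Mm dm]] := choice dex.
have [x mx] : exists x, m @ \oo --> x.
  apply: sqn_cauchy_cvg => e e0.
  have e40 : 0 < e / 4 by rewrite divr_gt0.
  have [N _ HN] := near_infty_natSinv_lt (PosNum e40).
  exists N => k l Nk Nl.
  have mkl : M (2^-1 *: (m l + m k)) by apply: MZ; apply: MD.
  (* The midpoint lies in [M], so it is at distance at least [d]. *)
  have E2 : (y - m l) + (y - m k) = 2 *: (y - 2^-1 *: (m l + m k)).
    rewrite scalerBr scalerA divff ?pnatr_eq0 // scale1r scaler_nat.
    by rewrite mulr2n opprD addrACA.
  have := sqn_parallelogram (y - m l) (y - m k).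
  have -> : (y - m l) - (y - m k) = m k - m l by rewrite opprB addrC addrA subrK.
  have -> : sqn (y - m l + (y - m k)) = 4 * sqn (y - 2^-1 *: (m l + m k)).
    apply: complexI; rewrite E2 sqnZ rmorphM /= rmorph_nat normr_nat.
    by rewrite -natrX.
  have := dle _ mkl; have := dm k; have := dm l.
  have /= := HN k Nk; have /= := HN l Nl.
  move: (sqn _) (sqn _) (sqn _) (sqn _) (k.+1%:R^-1) (l.+1%:R^-1) => *; lra.
have Mx : M x := Mcl _ _ Mm mx.
exists x => //.
have xd : sqn (y - x) <= d.
  rewrite -[d]addr0.
  apply: (@ler_cvg_to _ \oo _ _ (fun k => sqn (y - m k))
    (fun k => d + harmonic k)).
  - by apply: sqn_cvg; apply: cvgB => //; exact: cvg_cst.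
  - by apply: cvgD; [exact: cvg_cst | exact: cvg_harmonic].
  - by apply: nearW => k; exact: ltW.
move=> z Mz; have [->|z0] := eqVneq z 0; first by rewrite hdot0r.
set c := hdot (y - x) z / hdot z z.
have := le_trans xd (dle _ (MD _ _ Mx (MZ c _ Mz))).
rewrite -lecR !sqnE opprD addrA hdot_residual // lerDl oppr_ge0.
rewrite ler_pdivrMr ?hdot_gt0 // mul0r => h.
by apply/eqP; rewrite -normr_eq0 -sqrf_eq0 eq_le h exprn_ge0.
Qed.
End Projection.

(** * Subspaces *)

Section Subspace.
Context {R : realType} {V : lmodType R[i]} {S : set V}.
Hypothesis Ssub : is_subspace S.

Lemma subspaceD x y : S x -> S y -> S (x + y).
Proof. by case: Ssub => _ Sl Sx Sy; rewrite -(scale1r x); apply: Sl. Qed.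

Lemma subspaceZ a x : S x -> S (a *: x).
Proof. by case: Ssub => S0 Sl Sx; rewrite -(addr0 (a *: x)); apply: Sl. Qed.

Lemma subspaceB x y : S x -> S y -> S (x - y).
Proof. by move=> Sx Sy; rewrite -scaleN1r; apply/subspaceD/subspaceZ. Qed.

Lemma subspace_sum (I : Type) (r : seq I) (F : I -> V) :
  (forall i, S (F i)) -> S (\sum_(i <- r) F i).
Proof.
move=> SF; elim/big_ind: _ => //; first exact: (proj1 Ssub).
exact: subspaceD.
Qed.

End Subspace.

(** * Finite orthonormal bases *)

Section OrthonormalBasis.
Context {R : realType} {X : hilbertSpace R}.

Definition orthonormal_family {m} (e : 'I_m -> X) :=
  forall i j, hdot (e i) (e j) = (i == j)%:R.

Lemma hdot_suml (I : Type) (r : seq I) (F : I -> X) y :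
  hdot (\sum_(i <- r) F i) y = \sum_(i <- r) hdot (F i) y.
Proof. exact: linear_sumlz. Qed.

Lemma hdot_sumr (I : Type) (r : seq I) (F : I -> X) y :
  hdot y (\sum_(i <- r) F i) = \sum_(i <- r) hdot y (F i).
Proof. exact: linear_sumr. Qed.

Lemma hdot_sum_family m (e : 'I_m -> X) (c : 'I_m -> R[i]) j :
  orthonormal_family e -> hdot (\sum_i c i *: e i) (e j) = c j.
Proof.
move=> oe; rewrite hdot_suml (bigD1 j) //= hdotZl oe eqxx mulr1.
rewrite big1 ?addr0 // => i ij; by rewrite hdotZl oe (negPf ij) mulr0.
Qed.

(** An inclusion of orthogonal complements stands in for the equality of spans,
    since only totality is at stake in [total_orthonormal_basis]. *)
Lemma gram_schmidt (s : seq X) : exists m (e : 'I_m -> X),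
  orthonormal_family e /\
  forall x, (forall i, hdot x (e i) = 0) -> forall v, v \in s -> hdot x v = 0.
Proof.
elim: s => [|v s [m [e [oe es]]]].
  by exists 0%N, (fun=> 0); split=> [[]|].
pose w := v - \sum_i hdot v (e i) *: e i.
have we i : hdot w (e i) = 0 by rewrite hdotBl (hdot_sum_family _ _ _ _ oe) subrr.
have ew i : hdot (e i) w = 0 by rewrite hdotC we conjC0.
have vw : v = w + \sum_i hdot v (e i) *: e i by rewrite subrK.
have xv x : (forall i, hdot x (e i) = 0) -> hdot x w = 0 -> hdot x v = 0.
  move=> xe xw; rewrite vw hdotDr xw add0r hdot_sumr big1 // => i _.
  by rewrite hdotZr xe mulr0.
have [w0|w0] := eqVneq w 0.
  exists m, e; split=> // x xe y; rewrite inE => /orP[/eqP->|]; last exact: es.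
  by apply: xv => //; rewrite w0 hdot0r.
have nw0 : `|w| != 0 by rewrite normr_eq0.
exists m.+1, (fun i => oapp e (`|w|^-1 *: w) (unlift ord_max i)); split.
  have nwc : Num.conj (`|w|^-1) = `|w|^-1.
    by rewrite conj_Creal // realV normr_real.
  move=> i j; case: unliftP => [i' ->|->]; case: unliftP => [j' ->|->] /=.
  - by rewrite oe (inj_eq lift_inj).
  - by rewrite hdotZr ew mulr0 eq_sym (negPf (neq_lift _ _)).
  - by rewrite hdotZl we mulr0 (negPf (neq_lift _ _)).
  - by rewrite hdotZl hdotZr nwc -hnormE expr2 mulKf // mulVf // eqxx.
move=> x xe; have xe' i : hdot x (e i) = 0.
  by have := xe (lift ord_max i); rewrite liftK.
move=> y; rewrite inE => /orP[/eqP->|]; last exact: es.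
apply: xv => //; have /eqP := xe ord_max.
rewrite unlift_none /= hdotZr mulf_eq0 conjC_eq0 invr_eq0 (negPf nw0) /=.
by move/eqP.
Qed.

Definition orthonormal_basis {m} (e : 'I_m -> X) :=
  orthonormal_family e /\ forall x, x = \sum_i hdot x (e i) *: e i.

Lemma total_orthonormal_basis (s : seq X) :
  (forall x, (forall v, v \in s -> hdot x v = 0) -> x = 0) ->
  exists m (e : 'I_m -> X), orthonormal_basis e.
Proof.
move=> st; have [m [e [oe es]]] := gram_schmidt s.
exists m, e; split=> // x; apply/eqP; rewrite -subr_eq0; apply/eqP/st/es => i.
by rewrite hdotBl (hdot_sum_family _ _ _ _ oe) subrr.
Qed.

End OrthonormalBasis.

(** * Adjoint relations *)

Section Adjoint.
Context {R : realType} {X : hilbertSpace R}.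
Implicit Types (T : relation_in X).

Lemma rel_adj_subspace T : is_subspace (rel_adj T).
Proof.
split=> [f _|a f g Tf Tg h Th] /=; first by rewrite !hdot0r.
by rewrite !hdotDr !hdotZr Tf // Tg.
Qed.

(** An adjoint is an intersection of kernels of continuous functionals. *)
Lemma rel_adj_seq_closed T (u v : nat -> X) x y :
  (forall n, rel_adj T (u n, v n)) -> u @ \oo --> x -> v @ \oo --> y ->
  rel_adj T (x, y).
Proof.
move=> Tuv ux vy f Tf /=.
have h1 : hdot f.2 (u n) @[n --> \oo] --> hdot f.2 x.
  by apply: hdot_cvg => //; exact: cvg_cst.
have h2 : hdot f.1 (v n) @[n --> \oo] --> hdot f.1 y.
  by apply: hdot_cvg => //; exact: cvg_cst.
have E : (fun n => hdot f.2 (u n)) = (fun n => hdot f.1 (v n)).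
  by apply/funext => n; apply: (Tuv n).
by rewrite E in h1; apply: (cvg_unique _ h1 h2).
Qed.

(** The cross terms cancel because [hdot f.2 f.1] is real; with the imaginary
    unit as shift, this makes the map [f |-> f.2 - i f.1] isometric on a
    symmetric relation. *)
Lemma sqn_shift_i (f : X * X) : hdot f.2 f.1 = hdot f.1 f.2 ->
  sqn (f.2 - 'i%R *: f.1) = sqn f.1 + sqn f.2.
Proof.
move=> fs; apply: complexI; rewrite rmorphD /= !sqnE.
rewrite hdotBl !hdotBr !hdotZl !hdotZr conjCi fs.
have := sqrCi R[i]; set j := Num.imaginary => j2.
transitivity (- j ^+ 2 * hdot f.1 f.1 + hdot f.2 f.2); first by ring.
by rewrite j2 opprK mul1r.
Qed.

Lemma cvg_sqn_cauchy (u : nat -> X) (x : X) : u @ \oo --> x ->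
  forall e : R, 0 < e -> exists N, forall k l, (N <= k)%N -> (N <= l)%N ->
     sqn (u k - u l) <= e.
Proof.
move=> ux e e0.
have : sqn (u n - x) @[n --> \oo] --> sqn (x - x).
  by apply: sqn_cvg; apply: cvgB => //; exact: cvg_cst.
have s0 : sqn (0 : X) = 0 by apply: complexI; rewrite sqnE hdot0l.
rewrite subrr s0 => /cvgrPdist_lt/(_ (e / 4)) [|N _ HN].
  by rewrite divr_gt0.
have {}HN k : (N <= k)%N -> sqn (u k - x) < e / 4.
  by move=> /HN /=; rewrite sub0r normrN ger0_norm ?sqn_ge0.
exists N => k l /HN Nk /HN Nl.
have := sqn_parallelogram (u k - x) (u l - x).
have -> : u k - x - (u l - x) = u k - u l by rewrite opprB addrA subrK.
have := sqn_ge0 (u k - x + (u l - x)).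
move: Nk Nl; lra.
Qed.

End Adjoint.

(** * The range of a closed symmetric relation shifted by the imaginary unit *)

Lemma conjCNi {R : realType} : Num.conj (- 'i%R : R[i]) = 'i%R.
Proof. by rewrite -conjCi conjCK. Qed.

Section Range.
Context {R : realType} {X : hilbertSpace R} (A : relation_in X).
Hypotheses (As : symmetric_relation A) (Ac : closed A).

Definition range_sub_i : set X :=
  [set y | exists2 f, A f & y = f.2 - 'i%R *: f.1].

Lemma range_sub_i_subspace : is_subspace range_sub_i.
Proof.
have [A0 Al] := proj1 As; split=> [|a _ _ [f Af ->] [g Ag ->]].
  by exists 0 => //=; rewrite scaler0 subr0.
exists (a *: f + g); first exact: Al.
by rewrite /= scalerBr scalerDr !scalerA (mulrC a) opprD addrACA.
Qed.

(** By [sqn_shift_i], a Cauchy sequence of images has Cauchy preimages, whose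
    limit lies in the closed relation [A]. *)
Lemma range_sub_i_closed (u : nat -> X) x :
  (forall k, range_sub_i (u k)) -> u @ \oo --> x -> range_sub_i x.
Proof.
move=> ur ux.
have /choice[f Ef] : forall k, exists g : X * X, A g /\ u k = g.2 - 'i%R *: g.1.
  by move=> k; have [g Ag ug] := ur k; exists g.
have bnd k l : sqn (u k - u l) =
    sqn ((f k).1 - (f l).1) + sqn ((f k).2 - (f l).2).
  have [[Ak uk] [Al ul]] := (Ef k, Ef l).
  have Akl : A (f k - f l) := subspaceB (proj1 As) _ _ Ak Al.
  rewrite -[RHS]/(sqn (f k - f l).1 + sqn (f k - f l).2) -sqn_shift_i /=.
    by rewrite uk ul scalerBr !opprD !opprK addrACA.
  exact: (proj2 As _ Akl _ Akl).
have uC := cvg_sqn_cauchy u x ux.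
have [a fa] : exists a : X, (fun k => (f k).1) @ \oo --> a.
  apply: sqn_cauchy_cvg => e /uC[N HN]; exists N => k l Nk Nl.
  by apply: le_trans (HN k l Nk Nl); rewrite bnd lerDl sqn_ge0.
have [b fb] : exists b : X, (fun k => (f k).2) @ \oo --> b.
  apply: sqn_cauchy_cvg => e /uC[N HN]; exists N => k l Nk Nl.
  by apply: le_trans (HN k l Nk Nl); rewrite bnd lerDr sqn_ge0.
have fab : f @ \oo --> (a, b).
  have -> : f = (fun k => ((f k).1, (f k).2)) by apply/funext => k; case: (f k).
  exact: cvg_pair fa fb.
exists (a, b) => /=.
  by apply: (closed_cvg A Ac _ _ fab); apply: nearW => k; case: (Ef k).
have uE : u = (fun k => (f k).2 - 'i%R *: (f k).1).
  by apply/funext => k; case: (Ef k).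
rewrite uE in ux; apply: (cvg_seq_unique _ _ _ ux).
by apply: cvgB => //; apply: cvgZl_tmp.
Qed.

(** The defect subspace at [-i] is the orthogonal complement of the range of
    [A - i]; as this range is closed, it is the whole biorthogonal complement. *)
Lemma perp_defect_range y :
  (forall g, rel_ker (rel_shift (rel_adj A) (- 'i%R)) g -> hdot y g = 0) ->
  range_sub_i y.
Proof.
move=> yk; have [m rm ym] := projection range_sub_i y range_sub_i_subspace
  range_sub_i_closed.
suff w0 : y - m = 0 by move/eqP: w0; rewrite subr_eq0 => /eqP->.
apply: hdot_eq0; rewrite hdotBl (hdotC m) ym // conjC0 subr0; apply: yk.
exists (y - m, - 'i%R *: (y - m)); last by rewrite /= subrr.
move=> f Af /=; rewrite hdotZr conjCNi.
have /ym : range_sub_i (f.2 - 'i%R *: f.1) by exists f.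
rewrite hdotC => /(congr1 Num.conj); rewrite conjCK conjC0 hdotBl hdotZl.
by move/eqP; rewrite subr_eq0 => /eqP.
Qed.

End Range.

(** * The boundary space has finite dimension *)

Section Triplet.
Context {R : realType} {X H : hilbertSpace R} (A : relation_in X) (n : nat)
  (G0 G1 : X * X -> H).
Hypotheses (As : symmetric_relation A) (Ac : closed A)
  (Am : deficiency_minus A n) (GT : boundary_triplet A G0 G1).

(** On [A] the left-hand side of the Green identity is zero against every
    element of the adjoint; surjectivity allows testing with the boundary values
    [G1 f] and [- G0 f], which yields a sum of two squares. *)
Lemma boundary_map_vanishes f : A f -> G0 f = 0 /\ G1 f = 0.
Proof.
have [_ _ Gs Gg] := GT => Af.
have [g Ag [g0 g1]] := Gs (G1 f) (- G0 f).
have := Gg f g (proj2 As f Af) Ag.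
rewrite (Ag f Af) subrr g0 g1 hdotNr opprK => /esym/eqP.
rewrite paddr_eq0 ?hdot_ge0 // => /andP[/eqP/hdot_eq0-> /eqP/hdot_eq0->].
by [].
Qed.

Lemma boundary_mapB f g : rel_adj A f -> rel_adj A g ->
  G0 (f - g) = G0 f - G0 g /\ G1 (f - g) = G1 f - G1 g.
Proof.
have [l0 l1 _ _] := GT => Af Ag.
by rewrite -!(addrC (- g)) -scaleN1r l0 // l1 // !scaleN1r -!(addrC (- _ g)).
Qed.

(** The [G0]-images of a basis of the defect subspace at [-i] are total. Indeed, if
    [h] is orthogonal to them, take [f] in the adjoint with [G0 f = 0] and
    [G1 f = h]. The Green identity makes [f.2 - i f.1] orthogonal to the defect
    subspace at [-i], so it equals [a.2 - i a.1] for some [a] in [A]. Then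
    [f - a] is a defect element at [i] with vanishing [G0], and the Green identity
    forces [f = a], whence [h = G1 a = 0]. *)
Lemma boundary_space_finite_dim :
  exists m (e : 'I_m -> H), orthonormal_basis e.
Proof.
have [l0 l1 Gs Gg] := GT.
have imi : 'Im (- 'i%R : R[i]) < 0 by rewrite raddfN /= Im_i oppr_lt0.
have [d [_ dE]] := Am _ imi.
have dN i : rel_adj A (d i, - 'i%R *: d i).
  have : rel_ker (rel_shift (rel_adj A) (- 'i%R)) (d i).
    rewrite dE; exists (fun j => (j == i)%:R).
    rewrite (bigD1 i) //= eqxx scale1r big1 ?addr0 // => j /negPf->.
    by rewrite scale0r.
  case=> -[x x'] Ax [-> /esym/eqP]; rewrite subr_eq0 => /eqP <-.
  by [].
pose s := [seq G0 (d i, - 'i%R *: d i) | i <- enum 'I_n].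
apply: (total_orthonormal_basis s) => h hs.
have {}hs i : hdot h (G0 (d i, - 'i%R *: d i)) = 0.
  by apply: hs; apply: map_f; rewrite mem_enum.
have [f Af [f0 f1]] := Gs 0 h.
have [a Aa fa] : range_sub_i A (f.2 - 'i%R *: f.1).
  apply: perp_defect_range => // g; rewrite dE => -[c ->].
  rewrite hdot_sumr big1 // => i _.
  have := Gg _ _ Af (dN i); rewrite f0 f1 hs hdot0l subrr /= hdotZr conjCNi.
  by rewrite hdotZr hdotBl hdotZl => ->; rewrite mulr0.
have [a0 a1] := boundary_map_vanishes _ Aa.
have Aa' := proj2 As _ Aa.
have [k0 k1] := boundary_mapB _ _ Af Aa'.
have Ak := subspaceB (rel_adj_subspace A) _ _ Af Aa'.
have kE : (f - a).2 = 'i%R *: (f - a).1.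
  move/eqP: fa; rewrite -subr_eq0 => fa; apply/eqP.
  rewrite -subr_eq0 /= scalerBr !opprD !opprK addrACA.
  by move: fa; rewrite !opprD !opprK.
have := Gg _ _ Ak Ak.
rewrite k0 f0 a0 subrr hdot0l hdot0r subrr kE hdotZl hdotZr conjCi mulNr opprK.
move/eqP; rewrite -mulr2n mulrn_eq0 /= mulf_eq0 (negPf (neq0Ci _)) /=.
move=> /eqP /hdot_eq0 k10.
have k20 : (f - a).2 = 0 by rewrite kE /= k10 scaler0.
have e1 : f.1 = a.1 by apply/eqP; rewrite -subr_eq0; apply/eqP.
have e2 : f.2 = a.2 by apply/eqP; rewrite -subr_eq0; apply/eqP.
by rewrite -f1 [f]surjective_pairing e1 e2 -surjective_pairing.
Qed.

End Triplet.

(** * Operators on a finite-dimensional space *)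

Section FiniteDimensionalOperators.
Context {R : realType} {H : hilbertSpace R} {m : nat} (e : 'I_m -> H).
Hypothesis eb : orthonormal_basis e.

(** Riesz representation, with the representing vector given by coordinates in
    the basis [e]. *)
Lemma op_adjP (B : {linear H -> H}) x y : hdot (B x) y = hdot x (op_adj B y).
Proof.
suff [z zP] : [set z : H | forall x, hdot (B x) y = hdot x z] !=set0.
  exact: (xgetPex 0 (ex_intro _ z zP)).
exists (\sum_i Num.conj (hdot (B (e i)) y) *: e i) => {}x /=.
rewrite {1}(proj2 eb x) linear_sum hdot_suml hdot_sumr; apply: eq_bigr => i _.
by rewrite linearZ hdotZl hdotZr conjCK mulrC.
Qed.

Lemma op_adjP' (B : {linear H -> H}) x y : hdot (op_adj B x) y = hdot x (B y).
Proof. by rewrite hdotC -op_adjP -hdotC. Qed.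

Lemma op_adj_linear (B : {linear H -> H}) a x y :
  op_adj B (a *: x + y) = a *: op_adj B x + op_adj B y.
Proof.
apply: hdot_inj => z.
by rewrite hdotDl hdotZl !op_adjP' hdotDl hdotZl.
Qed.

Lemma injective_linear_surjective (B : H -> H) :
  (forall a x y, B (a *: x + y) = a *: B x + B y) ->
  (forall x, B x = 0 -> x = 0) -> forall y, exists x, B x = y.
Proof.
move=> Bl Binj y.
have B0 : B 0 = 0.
  by have := Bl (-1) 0 0; rewrite scaler0 addr0 scaleN1r addNr.
have Bsum (c : 'I_m -> R[i]) : B (\sum_i c i *: e i) = \sum_i c i *: B (e i).
  by elim/big_rec2: _ => // i v w _ <-; rewrite Bl.
pose M := \matrix_(i, j) hdot (B (e i)) (e j).
have BM (c : 'rV_m) : B (\sum_i c 0 i *: e i) = \sum_j (c *m M) 0 j *: e j.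
  rewrite Bsum; under eq_bigr do rewrite (proj2 eb (B _)) scaler_sumr.
  rewrite exchange_big; apply: eq_bigr => j _ /=; rewrite mxE scaler_suml.
  by apply: eq_bigr => i _; rewrite mxE scalerA.
have oe := proj1 eb.
have Mu : M \in unitmx.
  rewrite -row_free_unit; apply: inj_row_free => c cM.
  have /Binj c0 : B (\sum_i c 0 i *: e i) = 0.
    by rewrite BM cM big1 // => j _; rewrite mxE scale0r.
  apply/rowP => i.
  by rewrite mxE -(hdot_sum_family _ _ (fun i => c 0 i) i oe) c0 hdot0l.
pose d : 'rV_m := \row_j hdot y (e j).
exists (\sum_i (d *m invmx M) 0 i *: e i).
rewrite BM mulmxKV // [RHS](proj2 eb); apply: eq_bigr => i _.
by rewrite mxE.
Qed.

Section Pair.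
Variables C0 C1 : {linear H -> H}.
Hypothesis Csurj : forall h, exists h0 h1, C0 h0 + C1 h1 = h.
Hypothesis Csym : forall u v,
  hdot (op_adj C1 u) (op_adj C0 v) = hdot (op_adj C0 u) (op_adj C1 v).

(** The symmetry relation cancels the cross terms in the squared norm of
    [adj C0 u + s adj C1 u], so this vector vanishes only if [u] is orthogonal
    to the ranges of [C0] and [C1], which span the space. In finite dimension
    injectivity gives surjectivity. *)
Lemma adjoint_combination_surjective (s : R[i]) : Num.conj s = - s -> s != 0 ->
  forall y, exists u, op_adj C0 u + s *: op_adj C1 u = y.
Proof.
move=> sN s0; apply: injective_linear_surjective => [a x y|u u0].
  by rewrite !op_adj_linear !scalerDr !scalerA (mulrC s a) addrACA.
have : hdot (op_adj C0 u + s *: op_adj C1 u) (op_adj C0 u + s *: op_adj C1 u) = 0.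
  by rewrite u0 hdot0l.
rewrite hdotDl !hdotDr !hdotZl !hdotZr Csym sN.
set p := hdot (op_adj C0 u) _; set q := hdot (op_adj C0 u) _.
set r := hdot (op_adj C1 u) _ => pqr.
have : p + `|s| ^+ 2 * r = 0 by rewrite -[RHS]pqr normCK sN; ring.
move/eqP; rewrite paddr_eq0 ?mulr_ge0 ?exprn_ge0 ?hdot_ge0 //.
rewrite mulf_eq0 sqrf_eq0 normr_eq0 (negPf s0) /=.
move=> /andP[/eqP/hdot_eq0 u00 /eqP/hdot_eq0 u10].
have [h0 [h1 uE]] := Csurj u; apply: hdot_eq0.
by rewrite -{1}uE hdotDl !op_adjP u00 u10 !hdot0r addr0.
Qed.

(** The kernel of [(C0, - C1)] is a self-adjoint relation: a solution is brought,
    by subtracting some [(adj C1 u, adj C0 u)], to the form [(k, i k)], and then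
    [k] is annihilated by [C0 - i C1], whose adjoint is surjective. *)
Lemma kernel_parametrization h h' : C0 h = C1 h' ->
  exists u, h = op_adj C1 u /\ h' = op_adj C0 u.
Proof.
move=> Ch.
have i0 : 'i%R != 0 :> R[i] by exact: neq0Ci.
have [u uE] := adjoint_combination_surjective (- 'i%R)
  ltac:(by rewrite conjCNi opprK) ltac:(by rewrite oppr_eq0) (h' - 'i%R *: h).
have C0u : C0 (op_adj C1 u) = C1 (op_adj C0 u).
  by apply: hdot_inj => v; rewrite !op_adjP Csym.
have h'E : h' - op_adj C0 u = 'i%R *: (h - op_adj C1 u).
  apply/eqP; rewrite subr_eq addrC; apply/eqP.
  by rewrite -[LHS](subrK ('i%R *: h)) -uE scaleNr scalerBr -addrA [- _ + _]addrC.
exists u; suff h0 : h - op_adj C1 u = 0.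
  split; first by apply/eqP; rewrite -subr_eq0 h0.
  by apply/eqP; rewrite -subr_eq0 h'E h0 scaler0.
have [y yE] := adjoint_combination_surjective 'i%R (conjCi _) i0 (h - op_adj C1 u).
apply: hdot_eq0; rewrite -{2}yE hdotDr hdotZr conjCi mulNr -!op_adjP.
have -> : C0 (h - op_adj C1 u) = 'i%R *: C1 (h - op_adj C1 u).
  rewrite -linearZ linearB /= C0u Ch -linearB; congr (C1 _).
  exact: h'E.
by rewrite hdotZl subrr.
Qed.

End Pair.

(** The difference quotients converge in operator norm, and the adjoint preserves
    this norm; [Num.conj] appears because the adjoint is conjugate-linear. *)
Lemma op_adj_derivative (F : R[i] -> {linear H -> H}) (z : R[i]) :
  entire_operator_function F -> forall u, exists v, forall e : R[i], 0 < e ->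
  exists2 d : R[i], 0 < d & forall w : R[i], `|w - z| < d ->
    `|op_adj (F w) u - op_adj (F z) u - Num.conj (w - z) *: v| <= e * `|w - z|.
Proof.
move=> [_ /(_ z)[D _ Dd]] u; exists (op_adj D u) => eps eps0.
have e'0 : 0 < eps / (`|u| + 1) by rewrite divr_gt0 // ltr_wpDl.
have [d d0 dP] := Dd _ e'0; exists d => // w wd.
have [->|wz] := eqVneq w z.
  by rewrite !subrr conjC0 scale0r subrr !normr0 mulr0.
set v := op_adj (F w) u - _ - _.
have wz0 : w - z != 0 by rewrite subr_eq0.
pose B x := (w - z)^-1 *: (F w x - F z x) - D x.
have vB x : hdot x v = (w - z) * hdot (B x) u.
  rewrite /v /B !hdotBr hdotZr conjCK hdotBl hdotZl hdotBl !op_adjP.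
  by rewrite mulrBr mulrA divff // mul1r.
have [->|v0] := eqVneq v 0; first by rewrite normr0 mulr_ge0 // ltW.
have nv : 0 < `|v| by rewrite normr_gt0.
rewrite -(ler_pM2l nv) -expr2 hnormE vB.
rewrite -[leLHS]ger0_norm; last by rewrite -vB hdot_ge0.
rewrite normrM.
apply: le_trans (_ : `|w - z| * (eps / (`|u| + 1) * `|v| * `|u|) <= _).
  by rewrite ler_wpM2l // (le_trans (cauchy_schwarz _ _)) // ler_wpM2r // dP.
have -> : `|v| * (eps * `|w - z|) = `|w - z| * (`|v| * eps) by ring.
rewrite ler_wpM2l //.
have -> : eps / (`|u| + 1) * `|v| * `|u| =
    (`|v| * eps) * (`|u| / (`|u| + 1)) by ring.
rewrite ler_piMr ?mulr_ge0 ?(ltW eps0) //.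
by rewrite ler_pdivrMr ?ltr_wpDl // mul1r lerDl.
Qed.

End FiniteDimensionalOperators.

(** * Vertical lines in the complex plane *)

Section Complex.
Context {R : realType}.

Lemma normcR (x : R) : `|x%:C| = `|x|%:C.
Proof. by rewrite normc_def /= expr0n addr0 sqrtr_sqr. Qed.

Lemma cvg_real_complex {T : Type} {F : set_system T} {FF : Filter F}
    (u : T -> R) (x : R) :
  u @ F --> x ->
  ((u n)%:C : (R[i] : numFieldType)) @[n --> F] --> (x%:C : (R[i] : numFieldType)).
Proof.
move=> ux; apply/cvgrPdist_lt => e e0.
have eE : (complex.Re e)%:C = e by rewrite RRe_real // gtr0_real.
have e0' : 0 < complex.Re e by rewrite -ltcR eE.
move/cvgrPdist_lt/(_ _ e0') : ux; apply: filterS => n.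
by rewrite -rmorphB normcR -ltcR eE.
Qed.

Definition vertical (t x : R) : R[i] := t%:C + 'i%R * x%:C.

Lemma conj_realC (x : R) : Num.conj (x%:C) = x%:C.
Proof. by rewrite conj_Creal // complex_real. Qed.

Lemma vertical_conj t x : Num.conj (vertical t x) = vertical t (- x).
Proof.
by rewrite /vertical rmorphD rmorphM /= conjCi !conj_realC mulNr rmorphN mulrN.
Qed.

Lemma vertical_Im t x : 'Im (vertical t x) = x%:C.
Proof. by rewrite Im_rect ?complex_real. Qed.

Lemma vertical0 t : vertical t 0 = t%:C.
Proof. by rewrite /vertical mulr0 addr0. Qed.

Lemma verticalB t x y : vertical t x - vertical t y = 'i%R * (x - y)%:C.
Proof. by rewrite /vertical opprD addrACA subrr add0r -mulrBr -rmorphB. Qed.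

End Complex.

(** * The adjoint family along a vertical line *)

Section PairAlongLine.
Context {R : realType} {H : hilbertSpace R} {m : nat} (e : 'I_m -> H).
Hypothesis eb : orthonormal_basis e.
Variable t : R.

(** With [z = t + i x], the operator is the adjoint of [F] at the conjugate of [z],
    which depends holomorphically on [z]. *)
Definition adjoint_on_line (F : R[i] -> {linear H -> H}) (u : H) (x : R) : H :=
  op_adj (F (Num.conj (vertical t x))) u.

Lemma adjoint_on_line0 F u : adjoint_on_line F u 0 = op_adj (F t%:C) u.
Proof. by rewrite /adjoint_on_line vertical_conj oppr0 vertical0. Qed.

Section OneOperator.
Variable (F : R[i] -> {linear H -> H}) (u : H).
Hypothesis Fe : entire_operator_function F.
Local Notation P := (adjoint_on_line F u).

Lemma adjoint_on_line_derivative : exists v, forall eps : R[i], 0 < eps ->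
  exists2 d : R, 0 < d & forall x : R, `|x| < d ->
    `|P x - P 0 - ('i%R * x%:C) *: v| <= eps * `|x|%:C.
Proof.
have [v vP] := op_adj_derivative e eb F (Num.conj (vertical t 0)) Fe u.
exists v => eps eps0; have [d d0 dP] := vP _ eps0.
have dE : (complex.Re d)%:C = d by rewrite RRe_real // gtr0_real.
exists (complex.Re d) => [|x xd]; first by rewrite -ltcR dE.
have E : Num.conj (vertical t x) - Num.conj (vertical t 0) = - 'i%R * x%:C.
  by rewrite !vertical_conj verticalB oppr0 subr0 rmorphN mulrN mulNr.
have nE : `|Num.conj (vertical t x) - Num.conj (vertical t 0)| = `|x|%:C.
  by rewrite E normrM normrN normCi mul1r normcR.
have := dP (Num.conj (vertical t x)).
rewrite nE -{1}dE ltcR => /(_ xd).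
by rewrite E rmorphM /= conjCNi conj_realC.
Qed.

Lemma adjoint_on_line_cvg {T : Type} {FT : set_system T} {FF : Filter FT}
    (x : T -> R) : x @ FT --> 0 -> P (x n) @[n --> FT] --> P 0.
Proof.
move=> x0; have [v vP] := adjoint_on_line_derivative.
have [d d0 dP] := vP 1 ltr01.
have xC : ((x n)%:C : (R[i] : numFieldType)) @[n --> FT] -->
    (0 : (R[i] : numFieldType)) by apply: cvg_real_complex.
have h1 : P (x n) - P 0 - ('i%R * (x n)%:C) *: v @[n --> FT] --> 0.
  apply/cvgr0Pnorm_le => eps eps0.
  have /cvgr0Pnorm_le/(_ _ eps0) := xC.
  have /cvgrPdist_lt/(_ _ d0) := x0; apply: filterS2 => n.
  rewrite sub0r normrN => xd xe.
  by apply: le_trans (dP _ xd) _; rewrite mul1r -normcR.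
have h2 : ('i%R * (x n)%:C) *: v @[n --> FT] --> ('i%R * 0) *: v.
  have hs : ('i%R * (x n)%:C : (R[i] : numFieldType)) @[n --> FT] -->
      ('i%R * 0 : (R[i] : numFieldType)).
    apply: cvgM; last exact: xC.
    exact: cvg_cst.
  exact: cvgZr_tmp.
have h3 : P 0 @[n --> FT] --> P 0 by exact: cvg_cst.
have -> : (fun n => P (x n)) = (fun n =>
    (P (x n) - P 0 - ('i%R * (x n)%:C) *: v) + ('i%R * (x n)%:C) *: v + P 0).
  by apply/funext => n; rewrite !subrK.
have E : 0 + ('i%R * 0) *: v + P 0 = P 0 by rewrite mulr0 scale0r !add0r.
rewrite -[X in _ --> X]E.
by apply: (cvgD _ h3); apply: (cvgD h1 h2).
Qed.

(** Points approach [0] from both sides, and the quotient is a convex combination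
    of the two one-sided difference quotients at [0]; this is why
    differentiability at a single point is enough. *)
Lemma adjoint_on_line_difference_quotient : exists v : H,
  forall {T : Type} {FT : set_system T} {FF : Filter FT} (x y : T -> R),
  (forall n, 0 < x n) -> (forall n, 0 < y n) ->
  x @ FT --> 0 -> y @ FT --> 0 ->
  ('i%R * (x n + y n)%:C)^-1 *: (P (x n) - P (- y n)) @[n --> FT] --> v.
Proof.
have [v vP] := adjoint_on_line_derivative.
exists v => T FT FF x y x0 y0 xc yc; apply/cvgrPdist_le => eps eps0.
have [d d0 dP] := vP _ eps0.
have /cvgrPdist_lt/(_ _ d0) := yc.
have /cvgrPdist_lt/(_ _ d0) := xc; apply: filterS2 => n.
rewrite !sub0r !normrN => xd yd.
have hx := dP _ xd.
have hy := dP (- y n) ltac:(by rewrite normrN).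
have s0 : 0 < x n + y n by rewrite addr_gt0.
set c := 'i%R * _.
have nc : `|c| = (x n + y n)%:C by rewrite normrM normCi mul1r normcR gtr0_norm.
have c0 : c != 0 by rewrite -normr_eq0 nc gt_eqF // ltcR.
rewrite -(ler_pM2l (_ : 0 < `|c|)) ?normr_gt0 // -normrZ.
rewrite scalerBr scalerA divff // scale1r.
rewrite distrC.
have -> : P (x n) - P (- y n) - c *: v =
    (P (x n) - P 0 - ('i%R * (x n)%:C) *: v)
    - (P (- y n) - P 0 - ('i%R * (- y n)%:C) *: v).
  rewrite /c rmorphD rmorphN mulrN mulrDr scalerDl scaleNr opprK.
  have aux (a b z p q : H) : a - b - (p + q) = (a - z - p) - (b - z + q).
    by rewrite [- (b - z + q)]opprD addrACA -opprD opprB addrA subrK.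
  exact: aux.
apply: le_trans (ler_normB _ _) _; apply: le_trans (lerD hx hy) _.
by rewrite normrN (gtr0_norm (x0 n)) (gtr0_norm (y0 n)) nc -mulrDr -rmorphD mulrC.
Qed.

End OneOperator.
End PairAlongLine.

(** * The Nevanlinna kernel of the pair *)

Section NevanlinnaKernel.
Context {R : realType} {H : hilbertSpace R} {m : nat} (e : 'I_m -> H).
Hypothesis eb : orthonormal_basis e.
Variables (C0 C1 : R[i] -> {linear H -> H}) (t : R).
Hypothesis CN : entire_nevanlinna_pair C0 C1.
Local Notation P0 := (adjoint_on_line t C0).
Local Notation P1 := (adjoint_on_line t C1).

(** The symmetry of the pair says that [(adj C1, adj C0)], taken at the conjugate
    point, solves the boundary condition. *)
Lemma adjoint_pair_solves (x : R) (u : H) : x != 0 ->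
  C0 (vertical t x) (P1 u x) = C1 (vertical t x) (P0 u x).
Proof.
move=> x0; have [_ _ _ sy _] := CN.
have xI : 'Im (vertical t x) != 0 by rewrite vertical_Im fmorph_eq0.
by have /eqP := sy _ xI u; rewrite subr_eq0 => /eqP.
Qed.

(** Off the real axis this is the symmetry of the pair, and at [x = 0] it follows
    by continuity. *)
Lemma adjoint_on_line_sym (x : R) (u v : H) :
  hdot (P1 u x) (P0 v (- x)) = hdot (P0 u x) (P1 v (- x)).
Proof.
have [e0 e1 _ _ _] := CN.
have nz y : y != 0 -> hdot (P1 u y) (P0 v (- y)) = hdot (P0 u y) (P1 v (- y)).
  move=> y0.
  have a0 := adjoint_pair_solves y u y0.
  have aj F : adjoint_on_line t F v (- y) = op_adj (F (vertical t y)) v.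
    by rewrite /adjoint_on_line vertical_conj opprK.
  by rewrite !aj -!(op_adjP e eb) a0.
have [->|] := eqVneq x 0; last exact: nz.
have hc : (harmonic : nat -> R) @ \oo --> 0 by exact: cvg_harmonic.
have hN : (- (harmonic n : R)) @[n --> \oo] --> 0.
  by rewrite -[0]oppr0; apply: cvgN.
have l1 : hdot (P1 u (harmonic n)) (P0 v (- (harmonic n))) @[n --> \oo] -->
    hdot (P1 u 0) (P0 v 0).
  by apply: hdot_cvg; apply: (adjoint_on_line_cvg e eb).
have l2 : hdot (P0 u (harmonic n)) (P1 v (- (harmonic n))) @[n --> \oo] -->
    hdot (P0 u 0) (P1 v 0).
  by apply: hdot_cvg; apply: (adjoint_on_line_cvg e eb).
rewrite oppr0.
have E : (fun n => hdot (P1 u (harmonic n)) (P0 v (- (harmonic n)))) =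
         (fun n => hdot (P0 u (harmonic n)) (P1 v (- (harmonic n)))).
  by apply/funext => n; apply: nz; rewrite gt_eqF // harmonic_gt0.
rewrite E in l1.
by apply: (cvg_unique _ l1 l2); exact: norm_hausdorff.
Qed.

Lemma adjoint_pair_sym (u v : H) :
  hdot (op_adj (C1 t%:C) u) (op_adj (C0 t%:C) v) =
  hdot (op_adj (C0 t%:C) u) (op_adj (C1 t%:C) v).
Proof.
by have := adjoint_on_line_sym 0 u v; rewrite oppr0 !adjoint_on_line0.
Qed.

(** The numerator vanishes when the first point is the conjugate of the second.
    Subtracting this zero turns the quotient into inner products of continuous
    vectors with difference quotients, so it has a limit when both points tend
    to [t] independently. *)
Lemma nevanlinna_kernel_gram (u : H) : exists a : R[i], forall eps : R, 0 < eps ->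
  exists N, forall k l, (N <= k)%N -> (N <= l)%N ->
    `|(hdot (P1 u (harmonic k)) (P0 u (harmonic l))
       - hdot (P0 u (harmonic k)) (P1 u (harmonic l)))
      / ('i%R * (harmonic k + harmonic l)%:C) - a| <= eps%:C.
Proof.
have [e0 e1 _ _ _] := CN.
have [v0 q0] := adjoint_on_line_difference_quotient e eb t C0 u e0.
have [v1 q1] := adjoint_on_line_difference_quotient e eb t C1 u e1.
exists (hdot v1 (P0 u 0) - hdot v0 (P1 u 0)) => eps eps0.
pose FF : set_system (nat * nat) := filter_prod \oo \oo.
have hc : (harmonic : nat -> R) @ \oo --> 0 by exact: cvg_harmonic.
have c1 : harmonic p.1 @[p --> FF] --> (0 : R).
  exact: (cvg_comp _ _ cvg_fst hc).
have c2 : harmonic p.2 @[p --> FF] --> (0 : R).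
  exact: (cvg_comp _ _ cvg_snd hc).
have g1 (p : nat * nat) : 0 < (harmonic p.1 : R) := harmonic_gt0 _.
have g2 (p : nat * nat) : 0 < (harmonic p.2 : R) := harmonic_gt0 _.
have FFf : Filter FF by exact: filter_prod_filter.
have Q0 := q0 _ FF FFf _ _ g1 g2 c1 c2.
have Q1 := q1 _ FF FFf _ _ g1 g2 c1 c2.
have L0 := adjoint_on_line_cvg e eb t C0 u e0 (FF := FFf) _ c2.
have L1 := adjoint_on_line_cvg e eb t C1 u e1 (FF := FFf) _ c2.
(* Both indices tend to infinity independently along [FF]. *)
have : hdot (('i%R * (harmonic p.1 + harmonic p.2)%:C)^-1 *:
      (P1 u (harmonic p.1) - P1 u (- harmonic p.2))) (P0 u (harmonic p.2))
    - hdot (('i%R * (harmonic p.1 + harmonic p.2)%:C)^-1 *: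
      (P0 u (harmonic p.1) - P0 u (- harmonic p.2))) (P1 u (harmonic p.2))
    @[p --> FF] --> hdot v1 (P0 u 0) - hdot v0 (P1 u 0).
  by apply: cvgB; apply: hdot_cvg.
move=> /cvgrPdist_le/(_ eps%:C); rewrite ltcR.
move=> /(_ eps0) [[S1 S2] /= [S1o S2o] Sin].
have [N _ HN] := filterI S1o S2o.
exists N => k l Nk Nl.
have /= := Sin (k, l) (conj (HN k Nk).1 (HN l Nl).2).
rewrite distrC; congr (`|_ - _| <= _).
rewrite !hdotZl -mulrBr mulrC; congr (_ * _).
have s : hdot (P1 u (- harmonic l)) (P0 u (harmonic l)) =
         hdot (P0 u (- harmonic l)) (P1 u (harmonic l)).
  by rewrite -[in P0 u (harmonic l)](opprK (harmonic l)) adjoint_on_line_sym opprK.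
by rewrite !hdotBl s opprB addrA subrK.
Qed.

End NevanlinnaKernel.

(** * Continuous lifting of boundary values *)

Section BoundaryLift.
Context {R : realType} {X H : hilbertSpace R} {m : nat} (e : 'I_m -> H).
Hypothesis eb : orthonormal_basis e.
Variables (A : relation_in X) (G0 G1 : X * X -> H).
Hypothesis GT : boundary_triplet A G0 G1.

Lemma linear_on_sum (G : X * X -> H) (c : 'I_m -> R[i]) (U : 'I_m -> X * X) :
  linear_on (rel_adj A) G -> (forall i, rel_adj A (U i)) ->
  G (\sum_i c i *: U i) = \sum_i c i *: G (U i).
Proof.
move=> Gl AU; have As := rel_adj_subspace A.
have G00 : G 0 = 0.
  have := Gl (-1) 0 0 (proj1 As) (proj1 As).
  by rewrite scaler0 addr0 scaleN1r addNr.
suff [] : rel_adj A (\sum_i c i *: U i) /\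
  G (\sum_i c i *: U i) = \sum_i c i *: G (U i) by [].
elim/big_rec2: _ => [|i y1 y2 _ [Ay <-]]; first by split => //; exact: (proj1 As).
split; last exact: Gl.
exact: (proj2 As).
Qed.

(** A linear right inverse of the boundary map, defined on the finite-dimensional
    space [H * H] by its values on a basis and therefore continuous. *)
Lemma boundary_lift : exists L : H -> H -> X * X,
  (forall x y, [/\ rel_adj A (L x y), G0 (L x y) = x & G1 (L x y) = y]) /\
  (forall (u v : nat -> H) x y, u @ \oo --> x -> v @ \oo --> y ->
     (L (u n) (v n)).1 @[n --> \oo] --> (L x y).1 /\
     (L (u n) (v n)).2 @[n --> \oo] --> (L x y).2).
Proof.
have [l0 l1 Gs Gg] := GT; have As := rel_adj_subspace A.
have /choice[U UP] : forall i, exists f, [/\ rel_adj A f, G0 f = e i & G1 f = 0].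
  by move=> i; have [f Af [? ?]] := Gs (e i) 0; exists f.
have /choice[V VP] : forall i, exists f, [/\ rel_adj A f, G0 f = 0 & G1 f = e i].
  by move=> i; have [f Af [? ?]] := Gs 0 (e i); exists f.
have AU i : rel_adj A (U i) by case: (UP i).
have AV i : rel_adj A (V i) by case: (VP i).
pose LU x := \sum_i hdot x (e i) *: U i; pose LV y := \sum_i hdot y (e i) *: V i.
have ALU x : rel_adj A (LU x).
  by apply: (subspace_sum As) => i; apply: (subspaceZ As).
have ALV x : rel_adj A (LV x).
  by apply: (subspace_sum As) => i; apply: (subspaceZ As).
exists (fun x y => LU x + LV y); split.
  move=> x y; rewrite -(scale1r (LU x)).
  rewrite l0 ?l1 // !scale1r /LU /LV !linear_on_sum //.
  split; first by apply: (subspaceD As); [exact: ALU | exact: ALV].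
    rewrite [X in _ + X]big1 ?addr0; last first.
      by move=> i _; case: (VP i) => _ -> _; rewrite scaler0.
    by rewrite [RHS](proj2 eb); apply: eq_bigr => i _; case: (UP i) => _ ->.
  rewrite [X in X + _]big1 ?add0r; last first.
    by move=> i _; case: (UP i) => _ _ ->; rewrite scaler0.
  by rewrite [RHS](proj2 eb); apply: eq_bigr => i _; case: (VP i) => _ _ ->.
have lim (W : 'I_m -> X) (u : nat -> H) (x : H) : u @ \oo --> x ->
    \sum_i hdot (u n) (e i) *: W i @[n --> \oo] --> \sum_i hdot x (e i) *: W i.
  move=> ux; elim: (index_enum _) => [|i s IHs].
    by rewrite big_nil; under eq_fun do rewrite big_nil; exact: cvg_cst.
  rewrite big_cons; under eq_fun do rewrite big_cons.
  apply: cvgD => //.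
  by apply: cvgZr_tmp; apply: hdot_cvg => //; exact: cvg_cst.
have fstE (c : 'I_m -> R[i]) (W : 'I_m -> X * X) :
    (\sum_i c i *: W i).1 = \sum_i c i *: (W i).1.
  by rewrite (big_morph fst (id1 := 0) (op1 := +%R)).
have sndE (c : 'I_m -> R[i]) (W : 'I_m -> X * X) :
    (\sum_i c i *: W i).2 = \sum_i c i *: (W i).2.
  by rewrite (big_morph snd (id1 := 0) (op1 := +%R)).
move=> u v x y ux vy; rewrite /LU /LV /=; split.
  rewrite !fstE; under eq_fun do rewrite !fstE.
  by apply: cvgD; apply: lim.
rewrite !sndE; under eq_fun do rewrite !sndE.
by apply: cvgD; apply: lim.
Qed.

End BoundaryLift.

(** * Shtraus families *)

Section Shtraus.
Context {R : realType} {X K : hilbertSpace R}.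
Variables (J : {linear X -> K}) (T : relation_in K) (A : relation_in X).
Hypotheses (Jiso : forall x y, hdot (J x) (J y) = hdot x y)
  (Ts : self_adjoint_relation T) (AT : forall f, A f -> T (J f.1, J f.2)).

Lemma isometry_cvg (u : nat -> X) (x : X) :
  u @ \oo --> x -> J (u n) @[n --> \oo] --> J x.
Proof.
have nJ y : `|J y| = `|y|.
  by apply/eqP; rewrite -(@eqrXn2 _ 2) // !hnormE Jiso.
move=> /cvgrPdist_lt ux; apply/cvgrPdist_lt => eps /ux; apply: filterS => n.
by rewrite -linearB nJ.
Qed.

(** The Green identity for the exit components: self-adjointness of [T] turns the
    boundary form of [f] and [g] into the inner product of these components. *)
Lemma shtraus_green l k r s (f g : X * X) :
  exit_space J r -> exit_space J s ->
  T (J f.1 + r, J f.2 + l *: r) -> T (J g.1 + s, J g.2 + k *: s) ->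
  (l - Num.conj k) * hdot r s = hdot f.1 g.2 - hdot f.2 g.1.
Proof.
move=> rJ sJ Tf; rewrite {1}(proj2 Ts) => /(_ _ Tf) /=.
have rx x : hdot r (J x) = 0 by apply: rJ; exists x.
have xs x : hdot (J x) s = 0 by rewrite hdotC sJ ?conjC0 //; exists x.
rewrite !hdotDl !hdotDr !hdotZl !hdotZr !Jiso !rx !xs !mulr0 !addr0 !add0r => E.
apply/eqP; rewrite mulrBl subr_eq addrAC eq_sym subr_eq; apply/eqP.
by rewrite [RHS]addrC E.
Qed.

Lemma shtraus_sub_adj l f : shtraus_family J T l f -> rel_adj A f.
Proof.
case=> r rJ Tf g /AT Tg.
have T0 : T (J g.1 + 0, J g.2 + l *: 0) by rewrite scaler0 !addr0.
have := shtraus_green l l 0 r g f _ rJ T0 Tf.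
rewrite hdot0l mulr0 => /(_ _)/esym/eqP; rewrite subr_eq0 => E; apply/esym/eqP/E.
by move=> y _; rewrite hdot0l.
Qed.

Lemma shtraus_real_sym (t : R) f g :
  shtraus_family J T t%:C f -> shtraus_family J T t%:C g ->
  hdot f.2 g.1 = hdot f.1 g.2.
Proof.
case=> r rJ Tf [s sJ Tg].
have := shtraus_green _ _ r s f g rJ sJ Tf Tg.
by rewrite conj_realC subrr mul0r => /esym/eqP; rewrite subr_eq0 => /eqP.
Qed.

Lemma rel_inv_shiftE (Y : hilbertSpace R) (S : relation_in Y) l x y :
  rel_inv (rel_shift S l) (x, y) <-> S (y, x + l *: y).
Proof.
split=> [[_ [[a b] Sab ->] /= [-> ->]]|Sxy]; first by rewrite subrK.
exists (y, x) => //; exists (y, x + l *: y) => //=; by rewrite addrK.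
Qed.

(** The compressed resolvent is the resolvent of the Shtraus relation at the same
    point. *)
Lemma compression_resolventE l f :
  compression J (rel_inv (rel_shift T l)) (f.2 - l *: f.1, f.1) <->
  shtraus_family J T l f.
Proof.
split=> [[u /= Tu uJ]|[r rJ Tf]].
  exists (u - J f.1) => //; move/rel_inv_shiftE: Tu.
  have -> : J f.1 + (u - J f.1) = u by rewrite addrC subrK.
  by rewrite linearB linearZ scalerBr addrA addrAC.
exists (J f.1 + r); last by rewrite /= addrC addKr.
apply/rel_inv_shiftE => /=.
by rewrite linearB linearZ scalerDr addrA subrK.
Qed.

End Shtraus.

Section Correspondence.
Context {R : realType} {X H K : hilbertSpace R}.
Variables (A : relation_in X) (G0 G1 : X * X -> H)
  (C0 C1 : R[i] -> {linear H -> H}) (J : {linear X -> K}) (T : relation_in K).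
Hypothesis CE : corresponding_extension A G0 G1 (tau_of C0 C1) J T.

Lemma shtraus_nonreal l f : 'Im l != 0 ->
  shtraus_family J T l f <->
  rel_adj A f /\ C0 l (G0 f) - C1 l (G1 f) = 0.
Proof.
move=> l0; rewrite -compression_resolventE (proj2 CE _ l0) rel_inv_shiftE subrK.
rewrite -surjective_pairing; split=> [[Af [[a b] /= ab [-> ->]]]|[Af Cf]].
  by split=> //; rewrite linearN opprK.
split=> //; exists (G0 f, - G1 f); last by rewrite /= opprK.
by rewrite /tau_of /= linearN.
Qed.

End Correspondence.

(** * The abstract boundary condition at a real point *)

Section Main.
Context {R : realType} {X H K : hilbertSpace R}.
Variables (A : relation_in X) (G0 G1 : X * X -> H)
  (C0 C1 : R[i] -> {linear H -> H}) (J : {linear X -> K}) (T : relation_in K)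
  (m : nat) (e : 'I_m -> H).
Hypotheses (eb : orthonormal_basis e) (GT : boundary_triplet A G0 G1)
  (CN : entire_nevanlinna_pair C0 C1)
  (CE : corresponding_extension A G0 G1 (tau_of C0 C1) J T).
Variable t : R.

(** Boundary values solving the condition at [t] are continued to the points
    [t + i / (k + 1)], where the Shtraus relation is already known. By the Green
    identity, the Gram matrix of the exit components is the Nevanlinna kernel,
    so these components form a Cauchy sequence, and closedness of [T] passes the
    membership to the limit. *)
Lemma boundary_condition_sub_shtraus f : rel_adj A f ->
  C0 t%:C (G0 f) - C1 t%:C (G1 f) = 0 -> shtraus_family J T t%:C f.
Proof.
move=> Af /eqP; rewrite subr_eq0 => /eqP Cf.
have [Ce0 Ce1 _ _ Csurj] := CN.
have [[Jiso Ts AT _] _] := CE.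
have [l0 l1 _ Gg] := GT.
have As := rel_adj_subspace A.
have Csym := adjoint_pair_sym e eb C0 C1 t CN.
have [u [u0 u1]] := kernel_parametrization e eb _ _ (Csurj t%:C) Csym _ _ Cf.
have [L [LP Lc]] := boundary_lift e eb A G0 G1 GT.
pose eps : nat -> R := harmonic.
pose h n := adjoint_on_line t C1 u (eps n).
pose h' n := adjoint_on_line t C0 u (eps n).
have eps0 : eps @ \oo --> 0 by exact: cvg_harmonic.
have hc : h @ \oo --> G0 f.
  by rewrite u0 -(adjoint_on_line0 t); apply: (adjoint_on_line_cvg e eb).
have h'c : h' @ \oo --> G1 f.
  by rewrite u1 -(adjoint_on_line0 t); apply: (adjoint_on_line_cvg e eb).
(* The constant correction makes [g] converge to [f] itself and not only to
   some element with the same boundary values. *)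
pose g n := L (h n) (h' n) + (f - L (G0 f) (G1 f)).
have gP n : [/\ rel_adj A (g n), G0 (g n) = h n & G1 (g n) = h' n].
  have [AL L0 L1] := LP (h n) (h' n); have [Af' f0 f1] := LP (G0 f) (G1 f).
  have Ad : rel_adj A (f - L (G0 f) (G1 f)) by apply: (subspaceB As).
  have [d0 d1] := boundary_mapB A G0 G1 GT _ _ Af Af'.
  rewrite /g -(scale1r (L (h n) (h' n))) l0 // l1 // !scale1r d0 d1 L0 L1 f0 f1.
  by rewrite !subrr !addr0; split=> //; apply: (subspaceD As).
have [Lc1 Lc2] := Lc h h' _ _ hc h'c.
have g1 : (g n).1 @[n --> \oo] --> f.1.
  rewrite -[f.1](subrKC (L (G0 f) (G1 f)).1) /g /=.
  by apply: cvgD => //; exact: cvg_cst.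
have g2 : (g n).2 @[n --> \oo] --> f.2.
  rewrite -[f.2](subrKC (L (G0 f) (G1 f)).2) /g /=.
  by apply: cvgD => //; exact: cvg_cst.
have epsn n : eps n != 0 by rewrite gt_eqF // harmonic_gt0.
have /choice[r rP] : forall n, exists r, exit_space J r /\
    T (J (g n).1 + r, J (g n).2 + vertical t (eps n) *: r).
  move=> n; have [Ag gh gh'] := gP n.
  have I0 : 'Im (vertical t (eps n)) != 0 by rewrite vertical_Im fmorph_eq0.
  have [|r rJ Tr] := (shtraus_nonreal A G0 G1 C0 C1 J T CE _ (g n) I0).2.
    by split=> //; rewrite gh gh' (adjoint_pair_solves C0 C1 t CN) ?subrr.
  by exists r.
have rgram k l : hdot (r k) (r l) =
    (hdot (h k) (h' l) - hdot (h' k) (h l)) / ('i%R * (eps k + eps l)%:C).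
  have [[rk Tk] [rl Tl]] := (rP k, rP l).
  have [[Ak k0 k1] [Al l0' l1']] := (gP k, gP l).
  have := shtraus_green _ _ Jiso Ts _ _ _ _ _ _ rk rl Tk Tl.
  rewrite vertical_conj verticalB opprK -opprB Gg // k0 k1 l0' l1' opprB => <-.
  rewrite mulrAC divff ?mul1r // mulf_neq0 ?neq0Ci //.
  by rewrite fmorph_eq0 gt_eqF // addr_gt0 // harmonic_gt0.
have [a aP] := nevanlinna_kernel_gram e eb C0 C1 t CN u.
have [rl rc] : exists x : K, r @ \oo --> x.
  apply: sqn_cauchy_cvg => d d0.
  have [N HN] := aP (d / 4) ltac:(by rewrite divr_gt0).
  exists N => k l Nk Nl.
  have E p q : (N <= p)%N -> (N <= q)%N -> `|hdot (r p) (r q) - a| <= (d / 4)%:C.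
    by move=> Np Nq; rewrite rgram; apply: HN.
  rewrite -lecR sqnE -[leLHS]ger0_norm ?hdot_ge0 //.
  (* All four Gram entries approach the same [a], so their alternating sum is
     small. *)
  have -> : hdot (r k - r l) (r k - r l) =
     ((hdot (r k) (r k) - a) - (hdot (r k) (r l) - a))
      - ((hdot (r l) (r k) - a) - (hdot (r l) (r l) - a)).
    by rewrite hdotBl !hdotBr; ring.
  have -> : d%:C = ((d / 4)%:C + (d / 4)%:C) + ((d / 4)%:C + (d / 4)%:C).
    by rewrite -!rmorphD; congr (_%:C); field.
  apply: le_trans (ler_normB _ _) _.
  by apply: lerD; apply: le_trans (ler_normB _ _) _; apply: lerD; apply: E.
exists rl.
  move=> y Jy; apply: (_ : hdot rl y = 0).
  have c1 : hdot (r n) y @[n --> \oo] --> hdot rl y.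
    by apply: hdot_cvg => //; exact: cvg_cst.
  have E : (fun n => hdot (r n) y) = (fun=> 0).
    by apply/funext => n; case: (rP n) => rJ _; apply: rJ.
  rewrite E in c1.
  have c2 : (0 : (R[i] : numFieldType)) @[n --> \oo] --> (0 : (R[i] : numFieldType)).
    exact: cvg_cst.
  by apply: (cvg_unique _ c1 c2); exact: norm_hausdorff.
have lc : (vertical t (eps n) : (R[i] : numFieldType)) @[n --> \oo] -->
    (t%:C : (R[i] : numFieldType)).
  rewrite -vertical0 /vertical; apply: cvgD; first exact: cvg_cst.
  apply: cvgM; first exact: cvg_cst.
  exact: cvg_real_complex.
rewrite (proj2 Ts).
apply: (rel_adj_seq_closed T (fun n => J (g n).1 + r n)
   (fun n => J (g n).2 + vertical t (eps n) *: r n)).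
- by move=> n; rewrite -(proj2 Ts); case: (rP n).
- by apply: cvgD => //; apply: isometry_cvg.
- apply: cvgD; first by apply: isometry_cvg.
  exact: cvgZ.
Qed.

(** The Shtraus relation at a real point is symmetric and, by
    [boundary_condition_sub_shtraus], contains elements with boundary values
    [(adj C1 u, adj C0 u)] for every [u]; testing against them gives the boundary
    condition weakly. *)
Lemma shtraus_sub_boundary_condition f : shtraus_family J T t%:C f ->
  C0 t%:C (G0 f) - C1 t%:C (G1 f) = 0.
Proof.
move=> Sf.
have [[Jiso Ts AT _] _] := CE.
have [_ _ _ Gg] := GT.
have Af := shtraus_sub_adj _ _ _ Jiso Ts AT _ _ Sf.
have Csym := adjoint_pair_sym e eb C0 C1 t CN.
have [L [LP _]] := boundary_lift e eb A G0 G1 GT.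
apply: hdot_inj => u; rewrite hdot0l hdotBl !(op_adjP e eb).
have [Ag g0 g1] := LP (op_adj (C1 t%:C) u) (op_adj (C0 t%:C) u).
have Sg : shtraus_family J T t%:C (L (op_adj (C1 t%:C) u) (op_adj (C0 t%:C) u)).
  apply: boundary_condition_sub_shtraus => //; rewrite g0 g1.
  apply: hdot_inj => v; rewrite hdot0l hdotBl !(op_adjP e eb) Csym.
  by rewrite subrr.
have := Gg _ _ Af Ag.
rewrite (shtraus_real_sym _ _ Jiso Ts _ _ _ Sf Sg) subrr g0 g1.
by move=> /esym/eqP; rewrite subr_eq0 => /eqP->; rewrite subrr.
Qed.

End Main.

Theorem proposition3p9 (R : realType) (X H : hilbertSpace R)
    (A : relation_in X) (n : nat) (G0 G1 : X * X -> H)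
    (C0 C1 : R[i] -> {linear H -> H})
    (K : hilbertSpace R) (J : {linear X -> K}) (At : relation_in K) :
  symmetric_relation A -> closed A ->
  deficiency_plus A n -> deficiency_minus A n ->
  boundary_triplet A G0 G1 ->
  entire_nevanlinna_pair C0 C1 ->
  corresponding_extension A G0 G1 (tau_of C0 C1) J At ->
  forall t : R,
    shtraus_family J At t%:C =
    [set f | rel_adj A f /\ C0 t%:C (G0 f) - C1 t%:C (G1 f) = 0].
Proof.
move=> As Ac _ Am GT CN CE t.
have [m [e eb]] := boundary_space_finite_dim A n G0 G1 As Ac Am GT.
apply/seteqP; split=> f /= => [Sf|[Af Cf]]; last first.
  exact: (boundary_condition_sub_shtraus A G0 G1 C0 C1 J At m e).
have [[Jiso Ts AT _] _] := CE.
split; first exact: (shtraus_sub_adj J At A Jiso Ts AT t%:C).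
exact: (shtraus_sub_boundary_condition A G0 G1 C0 C1 J At m e).
Qed.
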